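(* For every ACT-R model with set of rules $\Sigma$ there is a set of rules $\Sigma'$ with the following property: for every rule $r=L\Rightarrow R$ in $\Sigma$ that is applicable in at least one abstract state (i.e. $r\sqsubseteq\sigma$ for some state $\sigma$), there is a rule $r'=L'\Rightarrow R$ in $\Sigma'$ that is in set normal form and such that for all abstract ACT-R states $\sigma,\sigma'$: $\sigma\rightarrowtail^{r}\sigma'$ if and only if $\sigma\rightarrowtail^{r'}\sigma'$ in the abstract semantics.
   Context: Fix disjoint sets of constants $\mathcal{C}$ and variables $\mathcal{V}$, a finite set of buffers $\mathbb{B}\subseteq\mathcal{C}$, a set of types $\mathbb{T}\subseteq\mathcal{C}$ and a typing function $\tau$ assigning each type a finite set of slot names, with $\mathtt{chunk}\in\mathbb{T}$, $\tau(\mathtt{chunk})=\emptyset$. A chunk store $\Delta$ is a multiset of chunks $(t,\mathrm{val})$, $\mathrm{val}:\tau(t)\to\Delta$, containing $\mathtt{nil}=(\mathtt{chunk},\emptyset)$, with an injective identifier function $\mathrm{id}_\Delta:\Delta\to\mathcal{C}$; $\mathrm{id}^{-1}_\Delta(x)$ is the chunk with identifier $x$ if it exists, else $\mathtt{nil}$. A fixed chunk merging operator $\circ$ on (partial) chunk stores is associative with neutral element $\emptyset$, identifier-consistent, idempotent on common parts, satisfies $\Delta'\subseteq\Delta'\circ\Delta''$ with identifiers preserved, and comes with a map $\mathrm{map}_{\Delta',\Delta''}:\Delta'\uplus\Delta''\to\Delta'\circ\Delta''$ that is the identity on $\Delta'$. An abstract state is $\sigma=\langle\Delta;\gamma;\upsilon\rangle$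 with $\gamma:\mathbb{B}\to\Delta\times\mathbb{R}_{\ge0}$ and $\upsilon$ a conjunction of ground atoms. A rule is $L\Rightarrow R$, $L$ a finite set of buffer tests $\mathrm{test}(b,t,P)$ ($b\in\mathbb{B}$, $t\in\mathbb{T}$, $P\subseteq\mathcal{C}\times(\mathcal{C}\cup\mathcal{V})$), $R$ a finite set of actions $a(b,t,P)$, $a\in\{=,+\}$, at most one per buffer, $\mathrm{vars}(R)\subseteq\mathrm{vars}(L)$. It is in set normal form if for each test $\mathrm{test}(b,t,P)\in L$ and each $s\in\tau(t)$ there is exactly one $v$ with $(s,v)\in P$. $r\sqsubseteq\sigma$ iff there is a substitution $\theta$ with, for every test $\mathrm{test}(b,t,P)\in L$, $\gamma(b)=((t,\mathrm{val}),0)$ and $\mathrm{id}_\Delta(\mathrm{val}(s))=v\theta$ for all $(s,v)\in P$; $\mathrm{Bindings}(r,\sigma)$ is the smallest such $\theta$. Actions: for $\gamma(b)=((t,\mathrm{val}_\gamma),d)$, $I(=(b,t,P),\sigma)=\{(\{c\},\gamma^*,\mathrm{true})\}$ with $c=(t,\mathrm{val}_b)$ fresh, $\gamma^*$ defined only at $b$, $\gamma^*(b)=(c,0)$, $\mathrm{val}_b(s)=\mathrm{id}^{-1}_\Delta(v)$ if $(s,v)\in P$, else $\mathrm{val}_\gamma(s)$; for architecture-given $\mathrm{request}_b(t,P,\upsilon)$ (a set of triples $(c^*,d^*,\upsilon^* )$), $I(+(b,t,P),\sigma)$ contains $(\{c^*\},\gamma^*,\upsilon^* )$ with $\gamma^*(b)=(c^*,1)$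 if $d^*>0$ else $(c^*,0)$. Effects combine by $(\Delta',\gamma',\upsilon')\sqcup(\Delta'',\gamma'',\upsilon'')=(\Delta'\circ\Delta'',\gamma,\upsilon'\wedge\upsilon'')$ with $\gamma$ the union of $\gamma',\gamma''$ with chunks mapped by $\mathrm{map}_{\Delta',\Delta''}$; $I(r,\sigma)=\bigsqcup_{\alpha\in R}I(\alpha,\sigma)$ (pairwise combinations). Apply transition: if $r\sqsubseteq\sigma$, $\theta=\mathrm{Bindings}(r,\sigma)$, $(\Delta^*,\gamma^*,\upsilon^* )\in I(r\theta,\sigma)$, then $\sigma\rightarrowtail^r\langle\Delta\circ\Delta^*;\gamma';\upsilon\wedge\upsilon^*\rangle$ with $\gamma'(b)=(\mathrm{map}_{\Delta,\Delta^*}(c),d)$ if $\gamma^*(b)=(c,d)$ is defined and $\gamma'(b)=\gamma(b)$ otherwise.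
   Formalization: The set of variables is assumed infinite, and the set P of slot-value pairs in each test and action is assumed finite; without these assumptions the claim can fail. *)

(* Defs.v *)
From mathcomp Require Import all_boot all_order all_algebra interval_inference.
From Stdlib Require List.
From mathcomp Require Import finmap all_classical all_reals.

Set Implicit Arguments.
Unset Strict Implicit.
Unset Printing Implicit Defensive.

Local Open Scope classical_set_scope.
Local Open Scope ring_scope.

Record signature := Signature {
  const : Type;
  var : Type;
  var_infinite : infinite_set [set: var];
  buffers : set const;
  buffers_finite : finite_set buffers;
  types : set const;
  slots : types -> set const;  (* the typing function tau *)
  slots_finite : forall t, finite_set (slots t);
  chunkt : types;  (* the type named "chunk" *)
  slots_chunkt : slots chunkt = set0
}.
Arguments buffers : clear implicits.
Arguments types : clear implicits.
Arguments chunkt : clear implicits.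

(* Constants and variables are disjoint: a term is an element of the sum. *)
Definition term (S : signature) : Type := (const S + var S)%type.

(* Chunk stores are multisets whose elements refer to each other, so chunks
   are represented by their occurrences: an occurrence determines its pair
   (t, val), but distinct occurrences may carry equal pairs.  [cval c s] is
   [val s], defined exactly on the slots of the type of [c].  Nothing else is
   assumed of the universe of occurrences (cyclic references are allowed). *)
Record chunk_universe (S : signature) := ChunkUniverse {
  chunk :> Type;
  ctype : chunk -> types S;
  cval : chunk -> const S -> option chunk;
  cval_dom : forall c s, cval c s <> None <-> slots (ctype c) s;
  nil_chunk : chunk;  (* the occurrence nil = (chunk, emptyset) *)
  nil_type : ctype nil_chunk = chunkt S
}.

(* A partial chunk store is given by its identifier function, a partial
   injection whose domain is the set of chunks of the store; chunks of a
   partial store may refer to chunks outside of it. *)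
Record pstore (S : signature) (U : chunk_universe S) := PStore {
  ident : U -> option (const S);
  ident_inj : forall c c' x, ident c = Some x -> ident c' = Some x -> c = c'
}.

Definition elts (S : signature) (U : chunk_universe S) (D : pstore U) : set U :=
  [set c | ident D c <> None].

Definition is_chunk_store (S : signature) (U : chunk_universe S)
    (D : pstore U) : Prop :=
  elts D (nil_chunk U) /\
  forall c s c', elts D c -> cval c s = Some c' -> elts D c'.

Lemma pstore0_inj (S : signature) (U : chunk_universe S) (c c' : U)
    (x : const S) : None = Some x -> None = Some x -> c = c'.
Proof. by []. Qed.

Definition pstore0 (S : signature) (U : chunk_universe S) : pstore U :=
  @PStore S U (fun _ => None) (@pstore0_inj S U).

Lemma pstore1_inj (S : signature) (U : chunk_universe S) (c : U)
    (x : const S) (c1 c2 : U) (y : const S) :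
  (if pselect (c1 = c) then Some x else None) = Some y ->
  (if pselect (c2 = c) then Some x else None) = Some y -> c1 = c2.
Proof. by do 2 case: pselect => //; move=> e1 e2 _ _; rewrite e1 e2. Qed.

(* The partial store {c}, in which c has identifier x. *)
Definition pstore1 (S : signature) (U : chunk_universe S) (c : U)
    (x : const S) : pstore U :=
  @PStore S U (fun c' => if pselect (c' = c) then Some x else None)
    (@pstore1_inj S U c x).

(* The chunk with identifier x if it exists, else nil. *)
Definition ident_inv (S : signature) (U : chunk_universe S) (D : pstore U)
    (x : const S) : U :=
  match pselect (exists c, ident D c = Some x) with
  | left h => projT1 (cid h)
  | right _ => nil_chunk U
  end.

(* Inclusion with the same identifiers. *)
Definition pstore_sub (S : signature) (U : chunk_universe S)
    (D D' : pstore U) : Prop :=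
  forall c x, ident D c = Some x -> ident D' c = Some x.

(* The union of the two identifier functions is again a partial injection. *)
Definition ident_compat (S : signature) (U : chunk_universe S)
    (D D' : pstore U) : Prop :=
  (forall c x y, ident D c = Some x -> ident D' c = Some y -> x = y) /\
  (forall c c' x, ident D c = Some x -> ident D' c' = Some x -> c = c').

(* Associativity and preservation of the identifiers of the right operand
   are only required of stores with compatible identifiers: associativity on
   all stores is in general inconsistent with merging compatible stores into
   their union.  An operator associative on all stores is an instance. *)
Record merging (S : signature) (U : chunk_universe S) := Merging {
  merge : pstore U -> pstore U -> pstore U;
  merge_map : pstore U -> pstore U -> U + U -> U;
  mergeA : forall D1 D2 D3,
    ident_compat D1 D2 -> ident_compat D1 D3 -> ident_compat D2 D3 ->
    merge D1 (merge D2 D3) = merge (merge D1 D2) D3;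
  merge0s : forall D, merge (pstore0 U) D = D;
  merges0 : forall D, merge D (pstore0 U) = D;
  merge_subl : forall D D', pstore_sub D (merge D D');
  merge_absorb : forall D D', pstore_sub D' D -> merge D D' = D;
  merge_mapl : forall D D' c, elts D c -> merge_map D D' (inl c) = c;
  merge_mapr : forall D D' c, elts D' c ->
    elts (merge D D') (merge_map D D' (inr c));
  merge_map_common : forall D D' c x,
    ident D c = Some x -> ident D' c = Some x -> merge_map D D' (inr c) = c;
  merge_ident : forall D D' c x, ident_compat D D' -> ident D' c = Some x ->
    elts D (merge_map D D' (inr c)) \/
    ident (merge D D') (merge_map D D' (inr c)) = Some x
}.

(* The data fixed by the architecture.  A conjunction of ground atoms is a
   finite set of atoms: [true] is the empty set, conjunction is union. *)
Record architecture (R : realType) := Architecture {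
  sign :> signature;
  univ : chunk_universe sign;
  mrg : merging univ;
  atom : choiceType;
  request : buffers sign -> types sign -> set (const sign * term sign) ->
    {fset atom} -> set (univ * {nonneg R} * {fset atom})
}.

Section Rules.
Context {R : realType} (A : architecture R).

Record test := Test {
  tbuf : buffers A;
  ttype : types A;
  tpairs : set (const A * term A)
}.

Inductive action_kind := Modify (* = *) | Request (* + *).

Record action := Action {
  akind : action_kind;
  abuf : buffers A;
  atype : types A;
  apairs : set (const A * term A)
}.

Definition vars_of (P : set (const A * term A)) : set (var A) :=
  [set x | exists s, P (s, inr x)].

(* A left-hand side may test the same buffer several times; only the
   right-hand side is restricted to one action per buffer. *)
Record rule := Rule {
  lhs : set test;
  rhs : set action;
  lhs_finite : finite_set lhs;
  rhs_finite : finite_set rhs;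
  lhs_pairs_finite : forall l, lhs l -> finite_set (tpairs l);
  rhs_pairs_finite : forall a, rhs a -> finite_set (apairs a);
  rhs_buffer : forall a a', rhs a -> rhs a' -> abuf a = abuf a' -> a = a';
  rhs_vars : \bigcup_(a in rhs) vars_of (apairs a)
    `<=` \bigcup_(l in lhs) vars_of (tpairs l)
}.

Definition set_normal_form (r : rule) : Prop :=
  forall l, lhs r l -> forall s, slots (ttype l) s ->
    exists! v, tpairs l (s, v).

Record state := State {
  store : pstore (univ A);
  store_total : is_chunk_store store;
  gamma : buffers A -> univ A * {nonneg R};
  gamma_store : forall b, elts store (gamma b).1;
  upsilon : {fset atom A}
}.

(* Substitutions are partial functions, ordered by extension. *)
Definition substitution := var A -> option (const A).

Definition subst_term (th : substitution) (v : term A) : term A :=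
  match v with
  | inl k => inl k
  | inr x => if th x is Some k then inl k else inr x
  end.

Definition subst_action (th : substitution) (a : action) : action :=
  Action (akind a) (abuf a) (atype a)
    [set (p.1, subst_term th p.2) | p in apairs a].

Definition test_holds (th : substitution) (sg : state) (l : test) : Prop :=
  let: (c, d) := gamma sg (tbuf l) in
  [/\ ctype c = ttype l, d%:num = 0 &
      forall s v, tpairs l (s, v) -> exists c' x,
        [/\ cval c s = Some c', ident (store sg) c' = Some x &
            subst_term th v = inl x]].

Definition matches (r : rule) (sg : state) (th : substitution) : Prop :=
  forall l, lhs r l -> test_holds th sg l.

Definition applicable (r : rule) (sg : state) : Prop :=
  exists th, matches r sg th.

Definition is_bindings (r : rule) (sg : state) (th : substitution) : Prop :=
  matches r sg th /\
  forall th', matches r sg th' -> forall x k, th x = Some k -> th' x = Some k.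

Record effect := Effect {
  estore : pstore (univ A);
  egamma : buffers A -> option (univ A * {nonneg R});
  eupsilon : {fset atom A}
}.

Definition effect0 : effect := Effect (pstore0 _) (fun _ => None) fset0.

Definition effect_join (e e' : effect) : effect :=
  let f := merge_map (mrg A) (estore e) (estore e') in
  Effect (merge (mrg A) (estore e) (estore e'))
    (fun b => match egamma e b, egamma e' b with
              | Some (c, d), _ => Some (f (inl c), d)
              | None, Some (c, d) => Some (f (inr c), d)
              | None, None => None
              end)
    (eupsilon e `|` eupsilon e')%fset.

(* [single_effect b c x d u] is the triple ({c}, gamma, u), with gamma defined
   at b only, gamma b = (c, d), and x the identifier of c in {c}. *)
Definition single_effect (b : buffers A) (c : univ A) (x : const A)
    (d : {nonneg R}) (u : {fset atom A}) : effect :=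
  Effect (pstore1 c x)
    (fun b' => if pselect (b' = b) then Some (c, d) else None) u.

(* A choice, for each buffer in X, of a chunk and of an identifier which are
   fresh with respect to D; choices for distinct buffers are distinct. *)
Definition fresh_choice (X : set (buffers A)) (D : pstore (univ A))
    (nu : buffers A -> univ A * const A) : Prop :=
  (forall b, X b ->
    ~ elts D (nu b).1 /\ forall c, ident D c <> Some (nu b).2) /\
  (forall b b', X b -> X b' ->
    (nu b).1 = (nu b').1 \/ (nu b).2 = (nu b').2 -> b = b').

(* Up to the choice nu of fresh chunks, the effect of a modification is
   unique.  A requested chunk which is already in the store keeps its
   identifier and otherwise receives a fresh one. *)
Definition action_effects (nu : buffers A -> univ A * const A) (sg : state)
    (a : action) : set effect :=
  let D := store sg in
  let b := abuf a in
  let P := apairs a in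
  match akind a with
  | Modify =>
      let cg := (gamma sg b).1 in
      let: (c, x) := nu b in
      [set e | [/\ ctype cg = atype a, ctype c = atype a,
        forall s, slots (atype a) s ->
          (forall v, P (s, inl v) -> cval c s = Some (ident_inv D v)) /\
          ((forall v, ~ P (s, v)) -> cval c s = cval cg s) &
        e = single_effect b c x 0%:nng fset0]]
  | Request =>
      [set e | exists c d u,
        request b (atype a) P (upsilon sg) (c, d, u) /\
        e = single_effect b c (odflt (nu b).2 (ident D c))
              (if 0 < d%:num then 1%:nng else 0%:nng) u]
  end.

Fixpoint seq_effects (nu : buffers A -> univ A * const A) (sg : state)
    (s : seq action) : set effect :=
  match s with
  | [::] => [set effect0]
  | a :: s' => [set effect_join e e'
                 | e in action_effects nu sg a & e' in seq_effects nu sg s']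
  end.

(* Merging need not be commutative: the actions of the finite set X may be
   combined in any order. *)
Definition set_effects (nu : buffers A -> univ A * const A) (sg : state)
    (X : set action) : set effect :=
  [set e | exists s, [/\ List.NoDup s, forall a, List.In a s <-> X a &
                         seq_effects nu sg s e]].

Definition apply_transition (r : rule) (sg sg' : state) : Prop :=
  exists th nu e,
    [/\ is_bindings r sg th,
        fresh_choice (abuf @` rhs r) (store sg) nu,
        set_effects nu sg (subst_action th @` rhs r) e &
        [/\ store sg' = merge (mrg A) (store sg) (estore e),
            gamma sg' = (fun b => match egamma e b with
              | Some (c, d) =>
                  (merge_map (mrg A) (store sg) (estore e) (inr c), d)
              | None => gamma sg b
              end) &
            upsilon sg' = (upsilon sg `|` eupsilon e)%fset]].

End Rules.

(* Main.v *)
(** A test may leave slots of its chunk type unconstrained, or constrain one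
    slot several times.  Since a left-hand side may test the same buffer
    repeatedly, the test [l] of a rule is split into one test without any of
    its pairs and one test for each of its pairs; in each of these tests all
    remaining slots of the type are filled by fresh variables, one variable for
    each buffer and slot.  A chunk of the right type assigns to every slot of
    the type an identifier, so the fresh variables only extend the bindings,
    and the right-hand side does not mention them. *)
Require Import Defs.
From mathcomp Require Import all_boot all_order all_algebra interval_inference.
From mathcomp Require Import finmap all_classical all_reals.

Set Implicit Arguments.
Unset Strict Implicit.
Unset Printing Implicit Defensive.

Local Open Scope classical_set_scope.

(** Removing a finite set from an infinite type leaves room for a copy of [nat], into which any
    finite set embeds. It supplies the fresh variables. *)
Lemma finite_inj_avoiding {T U : Type} (D : set T) (V : set U) :
  finite_set D -> infinite_set [set: U] -> finite_set V ->
  exists f : T -> U, {in D &, injective f} /\ forall x, D x -> ~ V (f x).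
Proof.
elim/Ppointed: U => U in V *.
  by move=> _ Uinf; case: (infinite_setN0 Uinf) => x; case: (U x).
move=> Dfin Uinf Vfin.
have /infiniteP leB := infinite_setD Uinf Vfin.
have leA : (D #<= [set: nat])%card by apply: finite_set_countable.
have /pcard_leP[f] := card_le_trans leA leB.
exists f; split; first exact: inj.
by move=> x Dx; have /= [_] : ([set: U] `\` V) (f x) by exact: funS.
Qed.

(** * Matching substitutions and their effect on transitions *)

Section SetNormalForm.
Context {R : realType} {A : architecture R}.
Implicit Types (r : rule A) (l : test A) (th : substitution A) (sg : state A).

Lemma test_holdsE th sg l :
  test_holds th sg l <->
  [/\ ctype (gamma sg (tbuf l)).1 = ttype l,
      ((gamma sg (tbuf l)).2%:num = 0)%R &
      forall s v, tpairs l (s, v) -> exists c x,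
        [/\ cval (gamma sg (tbuf l)).1 s = Some c, ident (store sg) c = Some x &
            subst_term th v = inl x]].
Proof. by rewrite /test_holds; case: (gamma sg (tbuf l)). Qed.

Definition lhs_vars r : set (var A) :=
  \bigcup_(l in lhs r) vars_of (tpairs l).

Lemma lhs_vars_finite r : finite_set (lhs_vars r).
Proof.
apply: bigcup_finite (lhs_finite r) _ => l rl.
pose g (p : const A * term A) : set (var A) := [set x | p.2 = inr x].
apply: (@sub_finite_set _ _ (\bigcup_(p in tpairs l) g p)).
  by move=> x [s lsx]; exists (s, inr x).
apply: bigcup_finite (lhs_pairs_finite rl) _ => -[s [k|x]] _.
  by apply: sub_finite_set (finite_set0 _) => y.
by apply: sub_finite_set (finite_set1 x) => y [].
Qed.

(** A tested pair forces its variable to be the identifier of a slot value, which depends on the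
    state alone. *)
Lemma matches_lhs_vars r sg th th' x :
  matches r sg th -> matches r sg th' -> lhs_vars r x -> th x = th' x.
Proof.
move=> mth mth' [l rl [s lsx]].
have /test_holdsE[_ _ /(_ _ _ lsx)[c [k [cs ck /= thx]]]] := mth l rl.
have /test_holdsE[_ _ /(_ _ _ lsx)[c' [k' [cs' ck' /= thx']]]] := mth' l rl.
move: cs'; rewrite cs => -[ecc']; move: ck'; rewrite -ecc' ck => -[ekk'].
move: thx thx'; case: (th x) => // ? [->]; case: (th' x) => // ? [->].
by rewrite ekk'.
Qed.

Lemma eq_matches r sg th th' :
  (forall x, lhs_vars r x -> th x = th' x) -> matches r sg th ->
  matches r sg th'.
Proof.
move=> eth mth l rl; have /test_holdsE[tl dl Pl] := mth l rl.
apply/test_holdsE; split=> // s v lsv.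
have [c [k [cs ck thv]]] := Pl s v lsv; exists c, k; split=> //.
case: v lsv thv => //= x lsx; rewrite eth //.
by exists l => //; exists s.
Qed.

Lemma eq_subst_action th th' (a : action A) :
  (forall x, vars_of (apairs a) x -> th x = th' x) ->
  subst_action th a = subst_action th' a.
Proof.
move=> eth; rewrite /subst_action; congr Action.
apply: eq_imagel => -[s [k|x]] //= asx; congr (_, _).
by rewrite eth //; exists s.
Qed.

(** Bindings enter a transition only through the instantiated actions, so the same fresh choice and
    the same effect can be reused. *)
Lemma apply_transition_imply r r' sg sg' : rhs r' = rhs r ->
  (forall th, is_bindings r sg th -> exists2 th', is_bindings r' sg th' &
    forall a x, rhs r a -> vars_of (apairs a) x -> th x = th' x) ->
  apply_transition r sg sg' -> apply_transition r' sg sg'.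
Proof.
move=> er bind [th [nu [e [bth fr eff tr]]]]; have [th' bth' eth] := bind th bth.
exists th', nu, e; split; rewrite ?er //.
suff -> : subst_action th' @` rhs r = subst_action th @` rhs r by [].
apply: eq_imagel => a ra; apply/esym/eq_subst_action => x.
exact: eth.
Qed.

(** Stores are closed under slot values; hence a variable put in a slot can always be bound. *)
Lemma slot_ident sg b s : slots (ctype (gamma sg b).1) s ->
  exists c k, cval (gamma sg b).1 s = Some c /\ ident (store sg) c = Some k.
Proof.
move=> /cval_dom; case E : (cval _ s) => [c|] // _.
have [_ closed] := store_total sg.
have := closed _ _ _ (@gamma_store _ _ sg b) E.
rewrite /elts /=; case ck : (ident _ c) => [k|] // _.
by exists c, k.
Qed.

(** * Filling the unconstrained slots *)

Section Fill.
Variable f : buffers A * const A -> var A.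

(** [None] keeps the type and delay conditions even if [l] has no pairs, and mentions every fresh
    variable of [l]. The last conjunct leaves the slot of a kept pair to that pair. *)
Definition fill_test l (q : option (const A * term A)) : test A :=
  Test (tbuf l) (ttype l)
    [set p | q = Some p \/
      [/\ slots (ttype l) p.1, p.2 = inr (f (tbuf l, p.1)) &
          forall p', q = Some p' -> p'.1 <> p.1]].

Definition fill_lhs r : set (test A) :=
  \bigcup_(l in lhs r) (fill_test l @` (None |` (Some @` tpairs l))).

Lemma fill_lhs_base r l : lhs r l -> fill_lhs r (fill_test l None).
Proof. by move=> rl; exists l => //; exists None => //; left. Qed.

Lemma fill_lhs_pair r l p :
  lhs r l -> tpairs l p -> fill_lhs r (fill_test l (Some p)).
Proof. by move=> rl lp; exists l => //; exists (Some p) => //; right; exists p. Qed.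

Lemma fill_lhs_finite r : finite_set (fill_lhs r).
Proof.
apply: bigcup_finite (lhs_finite r) _ => l rl; apply: finite_image.
rewrite finite_setU; split; first exact: finite_set1.
exact: finite_image (lhs_pairs_finite rl).
Qed.

Lemma fill_lhs_pairs_finite r l : fill_lhs r l -> finite_set (tpairs l).
Proof.
case=> {}l rl [q _ <-] /=.
pose X := (fun s => (s, inr (f (tbuf l, s))) : const A * term A) @`
  slots (ttype l).
have Xfin : finite_set X by exact/finite_image/slots_finite.
case: q => [p|].
  apply: (@sub_finite_set _ _ (p |` X)).
    by move=> [s v] [[<-]|[/= ls -> _]]; [left|right; exists s].
  by rewrite finite_setU; split=> //; exact: finite_set1.
by apply: sub_finite_set Xfin => -[s v] [|[/= ls -> _]] //; exists s.
Qed.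

Lemma fill_rhs_vars r : \bigcup_(a in rhs r) vars_of (apairs a)
  `<=` \bigcup_(l in fill_lhs r) vars_of (tpairs l).
Proof.
move=> x /rhs_vars[l rl [s lsx]].
by exists (fill_test l (Some (s, inr x)));
  [exact: fill_lhs_pair|exists s; left].
Qed.

Definition fill_rule r : rule A :=
  Rule (fill_lhs_finite r) (rhs_finite r) (@fill_lhs_pairs_finite r)
    (@rhs_pairs_finite _ _ r) (@rhs_buffer _ _ r) (@fill_rhs_vars r).

Lemma fill_rule_normal r : set_normal_form (fill_rule r).
Proof.
move=> l [{}l rl [q _ <-]] s /= ls.
have [[v qs]|qs] := pselect (exists v, q = Some (s, v)).
  exists v; split=> [|v' /= [|[_ _ /(_ _ qs)]]] //; first by left.
  by rewrite qs => -[].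
exists (inr (f (tbuf l, s))); split=> [|v' /= [e|[_ -> _]]] //.
  by right; split=> // -[s' v'] /= e es; apply: qs; exists v'; rewrite e es.
by case: qs; exists v'.
Qed.

Lemma fill_matches r sg th : matches (fill_rule r) sg th -> matches r sg th.
Proof.
move=> mth l rl; apply/test_holdsE.
have /test_holdsE[tl dl _] := mth _ (fill_lhs_base rl); split=> // s v lsv.
have /test_holdsE[_ _ ] := mth _ (fill_lhs_pair rl lsv).
by apply; left.
Qed.

Definition filled_slots r : set (buffers A * const A) :=
  \bigcup_(l in lhs r) ((fun s => (tbuf l, s)) @` slots (ttype l)).

Lemma filled_slots_finite r : finite_set (filled_slots r).
Proof.
apply: bigcup_finite (lhs_finite r) _ => l rl.
exact/finite_image/slots_finite.
Qed.

(** A fresh variable receives the identifier of the value of its slot; injectivity of [f] makes the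
    chosen [p] unique. *)
Definition fill_subst r sg th : substitution A := fun x =>
  if pselect (exists p, filled_slots r p /\ f p = x) is left h then
    let p := projT1 (cid h) in obind (ident (store sg)) (cval (gamma sg p.1).1 p.2)
  else th x.

Variable r : rule A.
Hypothesis f_inj : {in filled_slots r &, injective f}.
Hypothesis f_fresh : forall p, filled_slots r p -> ~ lhs_vars r (f p).

Lemma fill_subst_fresh sg th p : filled_slots r p ->
  fill_subst r sg th (f p) =
  obind (ident (store sg)) (cval (gamma sg p.1).1 p.2).
Proof.
move=> rp; rewrite /fill_subst; case: pselect => [h|[]]; last by exists p.
by case: (cid h) => p' [rp' /f_inj] /= -> //; apply/mem_set.
Qed.

Lemma fill_subst_lhs sg th x : lhs_vars r x -> fill_subst r sg th x = th x.
Proof.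
move=> rx; rewrite /fill_subst; case: pselect => // -[p [rp fx]].
by case: (f_fresh rp); rewrite fx.
Qed.

Lemma fill_subst_matches sg th :
  matches r sg th -> matches (fill_rule r) sg (fill_subst r sg th).
Proof.
move=> mth _ [l rl [q rq <-]].
(* Freshness of [f] keeps the new values away from the variables of [r], so the original pairs still
   hold. *)
have : matches r sg (fill_subst r sg th).
  by apply: eq_matches mth => x rx; rewrite fill_subst_lhs.
move=> /(_ l rl)/test_holdsE[tl dl Pl].
apply/test_holdsE; split=> // s v /= [e|[/= ls -> _]].
  by apply: Pl; case: rq => [|[p lp]]; rewrite e // => -[<-].
have [c [k [cs ck]]] : exists c k,
    cval (gamma sg (tbuf l)).1 s = Some c /\ ident (store sg) c = Some k.
  by apply: slot_ident; rewrite tl.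
exists c, k; split=> //=; rewrite fill_subst_fresh /= ?cs /= ?ck //.
by exists l => //; exists s.
Qed.

Lemma fill_subst_bindings sg th :
  is_bindings r sg th -> is_bindings (fill_rule r) sg (fill_subst r sg th).
Proof.
move=> [mth minth]; split; first exact: fill_subst_matches.
move=> th' mth' x k.
have mfill := fill_subst_matches mth.
(* Minimality: a fresh variable occurs in a base test, so every match gives it the same value; on
   other variables the minimality of [th] applies, since [th'] also matches [r]. *)
have [[p [[l rl [s ls <-]] <-]] |nx] :=
    pselect (exists p, filled_slots r p /\ f p = x).
  rewrite (@matches_lhs_vars _ _ _ _ _ mfill mth') //.
  exists (fill_test l None); first exact: fill_lhs_base.
  by exists s; right.
rewrite /fill_subst; case: pselect => // _.
exact: (minth _ (fill_matches mth')).
Qed.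

End Fill.

(** Restricting a match to the variables of the left-hand side gives the least one, as the values
    there are forced. *)
Lemma bindings_ex r sg th :
  matches r sg th -> exists2 th', is_bindings r sg th' &
    forall x, lhs_vars r x -> th x = th' x.
Proof.
move=> mth.
pose th' x := if pselect (lhs_vars r x) then th x else None.
have eth x : lhs_vars r x -> th x = th' x.
  by rewrite /th'; case: pselect.
have mth' := eq_matches eth mth.
exists th' => //; split=> // th'' mth'' x k.
have [rx|rx] := pselect (lhs_vars r x).
  by rewrite (matches_lhs_vars mth' mth'' rx).
by rewrite /th'; case: pselect.
Qed.

End SetNormalForm.

Theorem mainTheorem2 (R : realType) (A : architecture R)
    (Sigma : set (rule A)) :
  exists Sigma' : set (rule A),
    forall r : rule A, Sigma r ->
      (exists sg : state A, applicable r sg) ->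
      exists r' : rule A,
        [/\ Sigma' r', rhs r' = rhs r, set_normal_form r' &
            forall sg sg' : state A,
              apply_transition r sg sg' <-> apply_transition r' sg sg'].
Proof.
(* [Sigma'] only has to contain the constructed rules, so all rules will do. *)
exists setT => r _ _.
have [f [f_inj f_fresh]] := finite_inj_avoiding (filled_slots_finite r)
  (@var_infinite A) (lhs_vars_finite r).
exists (fill_rule f r); split=> //; first exact: fill_rule_normal.
move=> sg sg'; split; apply: apply_transition_imply => // th.
  move=> bth; exists (fill_subst f r sg th); first exact: fill_subst_bindings.
  by move=> a x ra ax; rewrite fill_subst_lhs //; apply: rhs_vars; exists a.
(* Bindings of the filled rule may also bind fresh variables, so they are cut down to the least
   match of [r]. *)
move=> [/fill_matches/bindings_ex[th' bth' eth] _]; exists th' => // a x ra ax.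
by apply: eth; apply: rhs_vars; exists a.
Qed.
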